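(* Suppose $\phi_1$ is a $\bigwedge\!\!\bigwedge$-sentence and $\phi_2$ is an $\mathcal{L}_{\omega_1\omega}$-sentence (in countable languages) with $\phi_1\models\phi_2$. Then there is a $\bigwedge\!\!\bigwedge$-sentence $\theta$ such that $\phi_1\models\theta$, $\theta\models\phi_2$, and every relation, function and constant symbol occurring in $\theta$ occurs in both $\phi_1$ and $\phi_2$.
   Context: $\mathcal{L}_{\omega_1\omega}$ is the infinitary logic allowing countable conjunctions and disjunctions (of formulas with finitely many free variables in total), negation and finitary quantifiers. The $\bigwedge\!\!\bigwedge$-formulas are defined inductively: every finitary quantifier-free formula is one; if $\varphi$ is one then so are $\exists x\,\varphi$ and $\forall x\,\varphi$; if $(\varphi_i)_{i\in\omega}$ are $\bigwedge\!\!\bigwedge$-formulas with finitely many free variables in total, then $\bigwedge\!\!\bigwedge_{i\in\omega}\varphi_i$ is one. *)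

(* Defs.v *)
From mathcomp Require Import all_boot.
Set Implicit Arguments. Unset Strict Implicit. Unset Printing Implicit Defensive.

Record signature := Signature {
  rel_sym : countType;
  rel_ar : rel_sym -> nat;
  fun_sym : countType;
  fun_ar : fun_sym -> nat;
  const_sym : countType }.

Section Syntax.
Variable S : signature.

Inductive term : Type :=
| tvar : nat -> term
| tconst : const_sym S -> term
| tapp : forall f : fun_sym S, ('I_(fun_ar f) -> term) -> term.

Inductive formula : Type :=
| fEq : term -> term -> formula
| fRel : forall r : rel_sym S, ('I_(rel_ar r) -> term) -> formula
| fNot : formula -> formula
| fAnd : formula -> formula -> formula
| fOr : formula -> formula -> formula
| fBigAnd : (nat -> formula) -> formula
| fBigOr : (nat -> formula) -> formula
| fEx : nat -> formula -> formula
| fAll : nat -> formula -> formula.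

Fixpoint tfv (t : term) (y : nat) : Prop :=
  match t with
  | tvar x => x = y
  | tconst _ => False
  | tapp _ a => exists i, tfv (a i) y
  end.

Fixpoint fv (p : formula) (y : nat) : Prop :=
  match p with
  | fEq t1 t2 => tfv t1 y \/ tfv t2 y
  | fRel _ a => exists i, tfv (a i) y
  | fNot q => fv q y
  | fAnd q1 q2 => fv q1 y \/ fv q2 y
  | fOr q1 q2 => fv q1 y \/ fv q2 y
  | fBigAnd qs => exists i, fv (qs i) y
  | fBigOr qs => exists i, fv (qs i) y
  | fEx x q => y <> x /\ fv q y
  | fAll x q => y <> x /\ fv q y
  end.

Definition fv_finite (p : formula) : Prop := exists n, forall y, fv p y -> y < n.

Fixpoint wf (p : formula) : Prop :=
  match p with
  | fEq _ _ | fRel _ _ => True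
  | fNot q => wf q
  | fAnd q1 q2 | fOr q1 q2 => wf q1 /\ wf q2
  | fBigAnd qs | fBigOr qs => (forall i, wf (qs i)) /\ fv_finite p
  | fEx _ q | fAll _ q => wf q
  end.

Definition sentence (p : formula) : Prop := wf p /\ forall y, ~ fv p y.

Inductive fin_qf : formula -> Prop :=
| fqf_eq t1 t2 : fin_qf (fEq t1 t2)
| fqf_rel r a : fin_qf (@fRel r a)
| fqf_not q : fin_qf q -> fin_qf (fNot q)
| fqf_and q1 q2 : fin_qf q1 -> fin_qf q2 -> fin_qf (fAnd q1 q2)
| fqf_or q1 q2 : fin_qf q1 -> fin_qf q2 -> fin_qf (fOr q1 q2).

Inductive WW : formula -> Prop :=
| WW_qf q : fin_qf q -> WW q
| WW_ex x q : WW q -> WW (fEx x q)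
| WW_all x q : WW q -> WW (fAll x q)
| WW_bigand qs : (forall i, WW (qs i)) -> fv_finite (fBigAnd qs) -> WW (fBigAnd qs).

Fixpoint t_occ_fun (g : fun_sym S) (t : term) : Prop :=
  match t with
  | tvar _ | tconst _ => False
  | tapp f a => f = g \/ exists i, t_occ_fun g (a i)
  end.

Fixpoint t_occ_const (c : const_sym S) (t : term) : Prop :=
  match t with
  | tvar _ => False
  | tconst d => d = c
  | tapp _ a => exists i, t_occ_const c (a i)
  end.

Fixpoint occ_rel (s : rel_sym S) (p : formula) : Prop :=
  match p with
  | fEq _ _ => False
  | fRel r _ => r = s
  | fNot q => occ_rel s q
  | fAnd q1 q2 | fOr q1 q2 => occ_rel s q1 \/ occ_rel s q2
  | fBigAnd qs | fBigOr qs => exists i, occ_rel s (qs i)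
  | fEx _ q | fAll _ q => occ_rel s q
  end.

Fixpoint occ_fun (g : fun_sym S) (p : formula) : Prop :=
  match p with
  | fEq t1 t2 => t_occ_fun g t1 \/ t_occ_fun g t2
  | fRel _ a => exists i, t_occ_fun g (a i)
  | fNot q => occ_fun g q
  | fAnd q1 q2 | fOr q1 q2 => occ_fun g q1 \/ occ_fun g q2
  | fBigAnd qs | fBigOr qs => exists i, occ_fun g (qs i)
  | fEx _ q | fAll _ q => occ_fun g q
  end.

Fixpoint occ_const (c : const_sym S) (p : formula) : Prop :=
  match p with
  | fEq t1 t2 => t_occ_const c t1 \/ t_occ_const c t2
  | fRel _ a => exists i, t_occ_const c (a i)
  | fNot q => occ_const c q
  | fAnd q1 q2 | fOr q1 q2 => occ_const c q1 \/ occ_const c q2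
  | fBigAnd qs | fBigOr qs => exists i, occ_const c (qs i)
  | fEx _ q | fAll _ q => occ_const c q
  end.

End Syntax.

Record structure (S : signature) := Structure {
  dom : Type;
  dom_inh : inhabited dom;
  rel_int : forall r : rel_sym S, ('I_(rel_ar r) -> dom) -> Prop;
  fun_int : forall f : fun_sym S, ('I_(fun_ar f) -> dom) -> dom;
  const_int : const_sym S -> dom }.

Section Semantics.
Variables (S : signature) (M : structure S).

Fixpoint teval (e : nat -> dom M) (t : term S) : dom M :=
  match t with
  | tvar x => e x
  | tconst c => @const_int S M c
  | tapp f a => @fun_int S M f (fun i => teval e (a i))
  end.

Definition upd (e : nat -> dom M) (x : nat) (d : dom M) : nat -> dom M :=
  fun y => if y == x then d else e y.

Fixpoint sat (e : nat -> dom M) (p : formula S) : Prop :=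
  match p with
  | fEq t1 t2 => teval e t1 = teval e t2
  | fRel r a => @rel_int S M r (fun i => teval e (a i))
  | fNot q => ~ sat e q
  | fAnd q1 q2 => sat e q1 /\ sat e q2
  | fOr q1 q2 => sat e q1 \/ sat e q2
  | fBigAnd qs => forall i, sat e (qs i)
  | fBigOr qs => exists i, sat e (qs i)
  | fEx x q => exists d, sat (upd e x d) q
  | fAll x q => forall d, sat (upd e x d) q
  end.

End Semantics.

Definition entails (S : signature) (p q : formula S) : Prop :=
  forall (M : structure S) (e : nat -> dom M), sat e p -> sat e q.

(* Main.v *)
(** If no conjunctive sentence in the common language separates [phi1] from the
negation of [phi2], a Henkin construction produces a model of both, contradicting
[phi1 |= phi2]. Its conditions are inseparable pairs [(P, Q)]: the left component
only ever splits finite disjunctions and picks witnesses, the right one also splits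
countable disjunctions. Inseparability survives because conjunctive formulas are
closed, up to equivalence, under quantifiers, finite disjunctions (for the left
splits) and countable conjunctions (for the right splits). Atomic formulas of the
common language are decided simultaneously on both sides, so the two limit theories
have a common canonical model. *)

Require Import Defs.
From mathcomp Require Import all_boot.
From mathcomp Require Import boolp.
Set Implicit Arguments. Unset Strict Implicit. Unset Printing Implicit Defensive.

Section Interpolation.
Variable S : signature.
Local Notation formula := (formula S).
Local Notation term := (term S).

(** * Free variables and languages *)

Lemma teval_tfv (M : structure S) (e e' : nat -> dom M) (t : term) :
  (forall y, tfv t y -> e y = e' y) -> teval e t = teval e' t.
Proof.
elim: t => [x|c|f a IH] h //=; first exact: h.
by congr (fun_int _); apply/funext => i; apply: IH => y hy; apply: h; exists i.
Qed.

Lemma sat_fv (p : formula) (M : structure S) (e e' : nat -> dom M) :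
  (forall y, fv p y -> e y = e' y) -> sat e p = sat e' p.
Proof.
have updE (e1 e2 : nat -> dom M) x q (h : forall y, y <> x /\ fv q y -> e1 y = e2 y) d y :
    fv q y -> upd e1 x d y = upd e2 x d y.
  by rewrite /upd => hy; case: eqP => // ne; apply: h.
elim: p e e' => [t1 t2|r a|q IH|q1 IH1 q2 IH2|q1 IH1 q2 IH2|qs IH|qs IH|x q IH|x q IH]
  e e' h /=.
- by congr (_ = _); apply: teval_tfv => y hy; apply: h; [left|right].
- by congr (rel_int _); apply/funext => i; apply: teval_tfv => y hy; apply: h; exists i.
- by congr (~ _); apply: IH.
- by congr (_ /\ _); [apply: IH1|apply: IH2] => y hy; apply: h; [left|right].
- by congr (_ \/ _); [apply: IH1|apply: IH2] => y hy; apply: h; [left|right].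
- by apply: eq_forall => i; apply: IH => y hy; apply: h; exists i.
- by apply: eq_exists => i; apply: IH => y hy; apply: h; exists i.
- by apply: eq_exists => d; apply: IH; apply: updE.
- by apply: eq_forall => d; apply: IH; apply: updE.
Qed.

Record language := Language {
  lang_rel : rel_sym S -> Prop;
  lang_fun : fun_sym S -> Prop;
  lang_const : const_sym S -> Prop }.

Definition t_inL (L : language) (t : term) : Prop :=
  (forall f, t_occ_fun f t -> lang_fun L f) /\
  (forall c, t_occ_const c t -> lang_const L c).

Definition inL (L : language) (p : formula) : Prop :=
  [/\ forall r, occ_rel r p -> lang_rel L r,
      forall f, occ_fun f p -> lang_fun L f &
      forall c, occ_const c p -> lang_const L c].

Lemma inL_and L p q : inL L (fAnd p q) <-> inL L p /\ inL L q.
Proof.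
split=> [[a b c]|[[a b c] [a' b' c']]].
  by split; split=> x hx; [apply: a|apply: b|apply: c|apply: a|apply: b|apply: c] => /=; tauto.
by split=> x /= [] hx; [apply: a|apply: a'|apply: b|apply: b'|apply: c|apply: c'].
Qed.

Lemma inL_bigand L qs : inL L (fBigAnd qs) <-> forall i, inL L (qs i).
Proof.
split=> [[a b c] i|h].
  by split=> x hx; [apply: a|apply: b|apply: c]; exists i.
by split=> x /= [i]; case: (h i) => a b c; [apply: a|apply: b|apply: c].
Qed.

Lemma inL_eq L t u : inL L (fEq t u) <-> t_inL L t /\ t_inL L u.
Proof.
split=> [[a b c]|[[b c] [b' c']]].
  by split; split=> x hx; [apply: b|apply: c|apply: b|apply: c] => /=; tauto.
by split=> x //= [] hx; [apply: b|apply: b'|apply: c|apply: c'].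
Qed.

Lemma inL_rel L r (a : 'I_(rel_ar r) -> term) :
  inL L (fRel a) <-> lang_rel L r /\ forall i, t_inL L (a i).
Proof.
split=> [[h b c]|[h b]].
  split; first exact: h.
  by move=> i; split=> x hx; [apply: b|apply: c]; exists i.
by split=> x /= => [<-//|[i]|[i]]; case: (b i) => b1 b2 hx; [apply: b1|apply: b2].
Qed.

Lemma t_inL_app L f (a : 'I_(fun_ar f) -> term) :
  t_inL L (tapp a) <-> lang_fun L f /\ forall i, t_inL L (a i).
Proof.
split=> [[b c]|[h b]].
  split; first by apply: b; left.
  by move=> i; split=> x hx; [apply: b; right|apply: c]; exists i.
split=> x /= => [[<-//|[i]]|[i]]; case: (b i) => b1 b2 hx; [exact: b1|exact: b2].
Qed.

(** * Semantic conditions *)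

(** A finite theory with Henkin constants is represented by its class of models, so consequence is
    inclusion and no proof calculus is involved. *)
Definition spred := forall M : structure S, (nat -> dom M) -> Prop.
Definition ent (P A : spred) := forall M (e : nat -> dom M), P M e -> A M e.
Definition sand (P A : spred) : spred := fun M e => P M e /\ A M e.
Definition sor (P A : spred) : spred := fun M e => P M e \/ A M e.
Definition snot (P : spred) : spred := fun M e => ~ P M e.

(* Henkin constants are natural numbers named by the environment [e], so a
   formula with constants is a formula [p] with a renaming of its variables, and
   no syntactic substitution is needed. *)
Definition rsat (rho : nat -> nat) (p : formula) : spred :=
  fun M e => sat (fun i => e (rho i)) p.
(** Coding the renaming by a finite list makes the assignments of constants to variables countable,
    so they can be enumerated. Variables past the end of [s] name the constant 0. *)
Definition fsat (s : seq nat) (p : formula) : spred := rsat (nth 0 s) p.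

(** The semantic counterpart of mentioning only the constants below [n]; finite support guarantees
    fresh constants. *)
Definition supp (n : nat) (P : spred) : Prop :=
  forall M (e e' : nat -> dom M), (forall i, i < n -> e i = e' i) -> P M e -> P M e'.

Lemma supp_upd n P m (M : structure S) (e : nat -> dom M) d :
  supp n P -> n <= m -> P M (upd e m d) <-> P M e.
Proof.
move=> hP nm.
have h i : i < n -> upd e m d i = e i.
  by move=> lt; rewrite /upd; case: eqP => // E; move: lt; rewrite E ltnNge nm.
by split; apply: hP => i /h.
Qed.

Lemma supp_le n m P : n <= m -> supp n P -> supp m P.
Proof. by move=> nm h M e e' E; apply: h => i lt; apply: E; apply: leq_trans lt nm. Qed.

Lemma supp_sand n P A : supp n P -> supp n A -> supp n (sand P A).
Proof. by move=> hP hA M e e' E [p a]; split; [apply: hP p|apply: hA a]. Qed.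

Lemma supp_snot n P : supp n P -> supp n (snot P).
Proof. by move=> hP M e e' E np p; apply: np; apply: hP p => i /E. Qed.

Lemma supp_fv n (p : formula) : (forall y, fv p y -> y < n) -> supp n (fun M e => sat e p).
Proof. by move=> h M e e' E; rewrite (@sat_fv p M e e')// => y /h /E. Qed.

(** A crude bound, convenient because it also covers the default 0. *)
Lemma nth_sumn (s : seq nat) i : nth 0 s i <= sumn s.
Proof.
elim: s i => [|x s IH] [|i] //=; first exact: leq_addr.
exact: leq_trans (IH i) (leq_addl _ _).
Qed.

Lemma supp_fsat s (p : formula) : supp (sumn s).+1 (fsat s p).
Proof.
move=> M e e' E; rewrite /fsat /rsat.
by have -> // : (fun i => e (nth 0 s i)) = (fun i => e' (nth 0 s i));
  apply/funext => i; apply: E; rewrite ltnS nth_sumn.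
Qed.

Lemma set_nth_upd (T : Type) (e : nat -> T) s x c :
  (fun i => e (nth 0 (set_nth 0 s x c) i)) =
  (fun i => if i == x then e c else e (nth 0 s i)).
Proof. by apply/funext => i; rewrite nth_set_nth /=; case: (i == x). Qed.

(** * Closure of the conjunctive formulas under disjunction *)

Fixpoint tren (rho : nat -> nat) (t : term) : term :=
  match t with
  | tvar x => tvar S (rho x)
  | tconst c => tconst c
  | tapp f a => tapp (fun i => tren rho (a i))
  end.

Lemma teval_tren rho t (M : structure S) (e : nat -> dom M) :
  teval e (tren rho t) = teval (fun i => e (rho i)) t.
Proof. by elim: t => //= f a IH; congr (fun_int _); apply/funext. Qed.

Lemma tfv_tren rho t y : tfv (tren rho t) y -> exists2 z, tfv t z & y = rho z.
Proof.
elim: t => //= [x <-|f a IH [i /IH [z hz ->]]]; first by exists x.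
by exists z => //; exists i.
Qed.

Lemma t_inL_tren L rho t : t_inL L t -> t_inL L (tren rho t).
Proof.
elim: t => //= f a IH /t_inL_app [hf ha].
by apply/t_inL_app; split=> // i; apply: IH.
Qed.

(** Renaming acts only on finitary quantifier-free formulas, where no capture can occur; the other
    formulas are returned unchanged. *)
Fixpoint qren (rho : nat -> nat) (p : formula) : formula :=
  match p with
  | fEq t u => fEq (tren rho t) (tren rho u)
  | fRel r a => fRel (fun i => tren rho (a i))
  | fNot q => fNot (qren rho q)
  | fAnd q1 q2 => fAnd (qren rho q1) (qren rho q2)
  | fOr q1 q2 => fOr (qren rho q1) (qren rho q2)
  | _ => p
  end.

Lemma fin_qf_qren rho p : fin_qf p -> fin_qf (qren rho p).
Proof. by elim=> /=; constructor. Qed.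

Lemma sat_qren rho p (M : structure S) (e : nat -> dom M) :
  fin_qf p -> sat e (qren rho p) = rsat rho p e.
Proof.
rewrite /rsat; elim=> [t u|r a|q _ IH|q1 q2 _ IH1 _ IH2|q1 q2 _ IH1 _ IH2] /=.
- by rewrite !teval_tren.
- by congr (rel_int _); apply/funext => i; rewrite teval_tren.
- by rewrite IH.
- by rewrite IH1 IH2.
- by rewrite IH1 IH2.
Qed.

Lemma fv_qren rho p y : fin_qf p -> fv (qren rho p) y -> exists2 z, fv p z & y = rho z.
Proof.
elim=> [t u|r a|q _ IH|q1 q2 _ IH1 _ IH2|q1 q2 _ IH1 _ IH2] /=.
- by case=> /tfv_tren [z hz ->]; exists z => //; [left|right].
- by case=> i /tfv_tren [z hz ->]; exists z => //; exists i.
- exact: IH.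
- by case=> [/IH1|/IH2] [z hz ->]; exists z => //; [left|right].
- by case=> [/IH1|/IH2] [z hz ->]; exists z => //; [left|right].
Qed.

Lemma inL_qren L rho p : fin_qf p -> inL L p -> inL L (qren rho p).
Proof.
elim=> [t u|r a|q _ IH|q1 q2 _ IH1 _ IH2|q1 q2 _ IH1 _ IH2] //=.
- by move=> /inL_eq [ht hu]; apply/inL_eq; split; apply: t_inL_tren.
- by move=> /inL_rel [hr ha]; apply/inL_rel; split=> // i; apply: t_inL_tren.
- by move=> /inL_and [/IH1 h1 /IH2 h2]; apply/inL_and.
- by move=> /inL_and [/IH1 h1 /IH2 h2]; apply/inL_and.
Qed.

(** Definable classes replace formulas, so that closure properties need hold only up to
    equivalence. *)
Definition defin (L : language) (n : nat) (P : spred) : Prop :=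
  exists t : formula, [/\ WW t, inL L t, forall y, fv t y -> y < n &
    forall M (e : nat -> dom M), sat e t <-> P M e].

Lemma defin_eq L n (P P' : spred) :
  (forall M (e : nat -> dom M), P M e <-> P' M e) -> defin L n P -> defin L n P'.
Proof. by move=> h [t [a b c d]]; exists t; split=> // M e; rewrite d. Qed.

Lemma defin_le L n m P : n <= m -> defin L n P -> defin L m P.
Proof. by move=> h [t [a b c d]]; exists t; split=> // y /c /leq_trans; apply. Qed.

Lemma defin_bigand L n (P : nat -> spred) :
  (forall i, defin L n (P i)) -> defin L n (fun M e => forall i, P i M e).
Proof.
move=> /choice [t h]; exists (fBigAnd t); split=> /=.
- by apply: WW_bigand => [i|]; [case: (h i)|exists n => y [i]; case: (h i) => _ _ + _; apply].
- by apply/inL_bigand => i; case: (h i).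
- by move=> y [i]; case: (h i) => _ _ + _; apply.
- by move=> M e; split=> H i; case: (h i) => _ _ _ E; apply/E.
Qed.

Lemma defin_and L n P Q : defin L n P -> defin L n Q -> defin L n (sand P Q).
Proof.
(* [fAnd] is available only between quantifier-free formulas, so a binary conjunction is the
   countable one [P, Q, Q, ...]. *)
move=> hP hQ; apply: (@defin_eq L n (fun M e => forall i, (if i == 0 then P else Q) M e)).
  move=> M e; split=> [h|[hp hq] [|i]] //.
  by split; [apply: (h 0)|apply: (h 1)].
by apply: defin_bigand => -[|i].
Qed.

(* The variable [n] is fresh for predicates supported below [n], hence serves as
   bound variable. *)
Lemma defin_ex L n (P : spred) :
  defin L n.+1 P -> defin L n (fun M e => exists d, P M (upd e n d)).
Proof.
move=> [t [a b c d]]; exists (fEx n t); split=> //=.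
- exact: WW_ex.
- by move=> y [ne /c]; rewrite ltnS leq_eqVlt => /orP [/eqP|].
- by move=> M e; split=> -[x hx]; exists x; apply/d.
Qed.

Lemma defin_all L n (P : spred) :
  defin L n.+1 P -> defin L n (fun M e => forall d, P M (upd e n d)).
Proof.
move=> [t [a b c d]]; exists (fAll n t); split=> //=.
- exact: WW_all.
- by move=> y [ne /c]; rewrite ltnS leq_eqVlt => /orP [/eqP|].
- by move=> M e; split=> hx x; apply/d.
Qed.

Lemma defin_qf L n rho q :
  fin_qf q -> inL L q -> (forall y, fv q y -> rho y < n) -> defin L n (rsat rho q).
Proof.
move=> hq Lq hrho; exists (qren rho q); split.
- exact/WW_qf/fin_qf_qren.
- exact: inL_qren.
- by move=> y /(fv_qren hq) [z /hrho hz ->].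
- by move=> M e; rewrite sat_qren.
Qed.

(** The bound variable [x] is sent to [n], which no other free variable of [q] reaches since their
    images lie below [n]. *)
Lemma rsat_bind n rho x q :
  (forall y, y <> x /\ fv q y -> rho y < n) ->
  exists2 rho', forall y, fv q y -> rho' y < n.+1 &
    forall M (e : nat -> dom M) d,
      rsat rho' q (upd e n d) = sat (upd (fun i => e (rho i)) x d) q.
Proof.
move=> hrho; exists (fun y => if y == x then n else rho y) => [y hy|M e d].
  by case: eqP => // ne; apply: leqW; apply: hrho.
apply: sat_fv => y hy; rewrite /upd; case: (y =P x) => [_|ne]; first by rewrite eqxx.
by case: eqP => // E; have := hrho y (conj ne hy); rewrite E ltnn.
Qed.

(** Disjunction with a fixed [X] commutes with countable conjunctions and with both quantifiers over
    variables outside the support of [X]; for the existential one this uses that domains are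
    nonempty. Only quantifier-free formulas remain. *)
Lemma defin_or_ind L n0 (X : spred) :
  supp n0 X ->
  (forall n rho q, n0 <= n -> fin_qf q -> inL L q -> (forall y, fv q y -> rho y < n) ->
     defin L n (sor (rsat rho q) X)) ->
  forall p, WW p -> forall n rho, n0 <= n -> inL L p ->
    (forall y, fv p y -> rho y < n) -> defin L n (sor (rsat rho p) X).
Proof.
move=> sX base p; elim=> {p} [q hq|x q _ IH|x q _ IH|qs _ IH _] n rho n0n Lp hrho.
- exact: base.
- have [rho' hrho' rhoE] := rsat_bind hrho.
  apply: (@defin_eq L n (fun M e => exists d, sor (rsat rho' q) X (upd e n d))).
    move=> M e; split.
      move=> [d [|]]; first by rewrite rhoE => h; left; exists d.
      by move/(supp_upd _ _ sX n0n); right.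
    case=> [[d hd]|h]; first by exists d; left; rewrite rhoE.
    by case: (dom_inh M) => d; exists d; right; apply/supp_upd; [exact: sX|exact: n0n|].
  apply: defin_ex; apply: IH => //; exact: leqW.
- have [rho' hrho' rhoE] := rsat_bind hrho.
  apply: (@defin_eq L n (fun M e => forall d, sor (rsat rho' q) X (upd e n d))).
    move=> M e; split.
      move=> h; case: (EM (X M e)) => hX; first by right.
      left=> d; case: (h d); first by rewrite rhoE.
      by move/(supp_upd _ _ sX n0n).
    case=> h d; first by left; rewrite rhoE.
    by right; apply/supp_upd; [exact: sX|exact: n0n|].
  apply: defin_all; apply: IH => //; exact: leqW.
- apply: (@defin_eq L n (fun M e => forall i, sor (rsat rho (qs i)) X e)).
    move=> M e; split.
      move=> h; case: (EM (X M e)) => hX; first by right.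
      by left=> i; case: (h i).
    by case=> h i; [left; apply: h|right].
  apply: defin_bigand => i; apply: IH => //; first by move/inL_bigand: Lp.
  by move=> y hy; apply: hrho; exists i.
Qed.

(** First [p] is taken apart with [q] as side predicate, then [q] with a quantifier-free piece [a]
    of [p] as side predicate; what is left is a disjunction of two quantifier-free formulas. *)
Lemma defin_or L n P Q : defin L n P -> defin L n Q -> defin L n (sor P Q).
Proof.
move=> [p [Wp Lp fp Ep]] [q [Wq Lq fq Eq]].
have rsat_id r M (e : nat -> dom M) : rsat id r e = sat e r by [].
apply: (@defin_eq L n (sor (rsat id p) (fun M e => sat e q))).
  by move=> M e; rewrite /sor rsat_id Ep Eq.
apply: (@defin_or_ind L n) => //; first exact: supp_fv.
move=> m rho a nm ha La hrho.
apply: (@defin_eq L m (sor (rsat id q) (rsat rho a))).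
  by move=> M e; rewrite /sor rsat_id; tauto.
have sa : supp m (rsat rho a).
  by move=> M e e' E; rewrite /rsat (@sat_fv a M _ (fun i => e' (rho i)))// => y /hrho /E.
apply: (@defin_or_ind L m) => //; last by move=> y /fq /leq_trans; apply.
move=> k sg b mk hb Lb hsg.
apply: (@defin_eq L k (rsat id (fOr (qren sg b) (qren rho a)))).
  by move=> M e; rewrite rsat_id /= !sat_qren.
apply: defin_qf => //.
- by constructor; apply: fin_qf_qren.
- by apply/inL_and; split; apply: inL_qren.
- move=> y /= [] /fv_qren; first by case=> // z /hsg hz ->.
  by case=> // z /hrho hz ->; apply: leq_trans mk.
Qed.

(* Universally quantifying the variables outside the support of [P]. *)
Lemma defin_trim L n m P A : supp n P -> ent P A -> defin L m A ->
  exists B, [/\ defin L n B, ent P B & ent B A].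
Proof.
move=> sP PA dA.
have {dA} : defin L (m + n) A by apply: defin_le dA; apply: leq_addr.
elim: m A PA => [|m IH] A PA dA; first by exists A; split.
have [|B [dB PB BA]] := IH _ _ (defin_all dA).
  by move=> M e hP d; apply: PA; apply: (proj2 (supp_upd e d sP (leq_addl m n))).
exists B; split=> // M e /BA /(_ (e (m + n))).
by have -> // : upd e (m + n) (e (m + n)) = e; apply/funext => i; rewrite /upd; case: eqP => // ->.
Qed.

(** * Inseparable pairs *)

Section Inseparable.
Variable L : language.

Definition sep (P Q : spred) : Prop :=
  exists n A, [/\ defin L n A, ent P A & ent A (snot Q)].

Definition good (P Q : spred) : Prop :=
  [/\ ~ sep P Q, exists n, supp n P & exists n, supp n Q].

Lemma common_supp P Q : good P Q -> forall m, exists n, [/\ m <= n, supp n P & supp n Q].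
Proof.
move=> [_ [i hi] [j hj]] m; exists (maxn m (maxn i j)); split; first exact: leq_maxl.
  by apply: supp_le hi; rewrite leq_max leq_maxl orbT.
by apply: supp_le hj; rewrite leq_max leq_maxr orbT.
Qed.

Lemma supp_sand_fsat P s (p : formula) :
  (exists n, supp n P) -> exists n, supp n (sand P (fsat s p)).
Proof.
move=> [n hn]; exists (maxn n (sumn s).+1); apply: supp_sand.
  by apply: supp_le hn; apply: leq_maxl.
by apply: supp_le (@supp_fsat s p); apply: leq_maxr.
Qed.

Lemma defin_pair n m A B : defin L n A -> defin L m B ->
  defin L (maxn n m) A /\ defin L (maxn n m) B.
Proof. by move=> dA dB; split; [apply: defin_le dA|apply: defin_le dB]; rewrite ?leq_maxl ?leq_maxr. Qed.

(** If [A] and [B] separate the two extensions of [P] from [Q], their disjunction separates [P] from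
    [Q]. *)
Lemma split_left P Q s (p : formula) : good P Q ->
  good (sand P (fsat s p)) Q \/ good (sand P (fsat s (fNot p))) Q.
Proof.
move=> g; have [ns sP sQ] := g; apply: contrapT => /not_orP [h1 h2].
have {h1} [n [A [dA PA AQ]]] : sep (sand P (fsat s p)) Q.
  by apply: contrapT => h; apply: h1; split=> //; apply: supp_sand_fsat.
have {h2} [m [B [dB PB BQ]]] : sep (sand P (fsat s (fNot p))) Q.
  by apply: contrapT => h; apply: h2; split=> //; apply: supp_sand_fsat.
have [dA' dB'] := defin_pair dA dB.
apply: ns; exists (maxn n m), (sor A B); split; first exact: defin_or.
  move=> M e hP; case: (EM (fsat s p e)) => hp; first by left; apply: PA; split.
  by right; apply: PB; split.
by move=> M e [/AQ|/BQ].
Qed.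

(** Separators for the various [i] could together use infinitely many constants. Trimming each to
    the support of [P] gives a common bound, and their countable conjunction then separates [P] from
    [Q]. *)
Lemma split_right_omega P Q s (ps : nat -> formula) : good P Q ->
  ent Q (fun M e => exists i, fsat s (ps i) e) ->
  exists i, good P (sand Q (fsat s (ps i))).
Proof.
move=> g hQ; have [ns [n sP] sQ] := g; apply: contrapT => /forallNP h.
have {h} /choice [B hB] : forall i, exists B,
    [/\ defin L n B, ent P B & ent B (snot (sand Q (fsat s (ps i))))].
  move=> i; apply: contrapT => h1; apply: (h i); split.
  - move=> [m [A [dA PA AQ]]]; apply: h1.
    have [B [dB PB BA]] := defin_trim sP PA dA.
    by exists B; split=> // M e /BA /AQ.
  - by exists n.
  - exact: supp_sand_fsat.
apply: ns; exists n, (fun M e => forall i, B i M e); split.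
- by apply: defin_bigand => i; case: (hB i).
- by move=> M e hP i; case: (hB i) => _ + _; apply.
- move=> M e hBe q; have [i hi] := hQ _ _ q.
  by case: (hB i) => _ _ /(_ M e (hBe i)); apply; split.
Qed.

Lemma split_right P Q s (p : formula) : good P Q ->
  good P (sand Q (fsat s p)) \/ good P (sand Q (fsat s (fNot p))).
Proof.
(* A binary split is a countable one whose alternatives are [fNot p] from index 1 on. *)
move=> g; have [|[|i] hi] := @split_right_omega P Q s (fun i => if i == 0 then p else fNot p) g.
- by move=> M e _; case: (EM (fsat s p e)) => h; [exists 0|exists 1].
- by left.
- by right.
Qed.

(** Given separators [A] for the case [a] and [B] for the case [fNot a], the disjunction of [a] with
    [A] and of [fNot a] with [B] separates [P] from [Q]; it is definable because [a] lies in the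
    common language. *)
Lemma split_both P Q s (a : formula) : good P Q -> fin_qf a -> inL L a ->
  good (sand P (fsat s a)) (sand Q (fsat s a)) \/
  good (sand P (fsat s (fNot a))) (sand Q (fsat s (fNot a))).
Proof.
move=> g qa La; have [ns sP sQ] := g; apply: contrapT => /not_orP [h1 h2].
have {h1} [n [A [dA PA AQ]]] : sep (sand P (fsat s a)) (sand Q (fsat s a)).
  by apply: contrapT => h; apply: h1; split=> //; apply: supp_sand_fsat.
have {h2} [m [B [dB PB BQ]]] : sep (sand P (fsat s (fNot a))) (sand Q (fsat s (fNot a))).
  by apply: contrapT => h; apply: h2; split=> //; apply: supp_sand_fsat.
have [dA' dB'] := defin_pair dA dB.
pose k := maxn (maxn n m) (sumn s).+1.
have bound (q : formula) y : fv q y -> nth 0 s y < k.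
  by move=> _; rewrite leq_max [X in _ || X]ltnS nth_sumn orbT.
have da : defin L k (fsat s a) by apply: defin_qf => //; apply: bound.
have dna : defin L k (fsat s (fNot a)).
  by apply: defin_qf; [constructor| |apply: bound].
have kA := defin_le (leq_maxl _ (sumn s).+1) dA'.
have kB := defin_le (leq_maxl _ (sumn s).+1) dB'.
apply: ns; exists k, (sor (sand (fsat s a) A) (sand (fsat s (fNot a)) B)); split.
- by apply: defin_or; apply: defin_and.
- move=> M e hP; case: (EM (fsat s a e)) => ha; [left|right].
    by split=> //; apply: PA.
  by split=> //; apply: PB.
- by move=> M e [[ha /AQ h]|[ha /BQ h]] hQ; apply: h.
Qed.

Lemma rsat_fresh s x n (q : formula) (M : structure S) (e : nat -> dom M) d :
  (sumn s).+1 <= n ->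
  fsat (set_nth 0 s x n) q (upd e n d) = sat (upd (fun i => e (nth 0 s i)) x d) q.
Proof.
move=> hn; rewrite /fsat /rsat set_nth_upd.
congr sat; apply/funext => i; rewrite /upd eqxx; case: (i == x) => //.
by case: eqP => // E; move: hn; rewrite -E ltnNge nth_sumn.
Qed.

(** The witness is a fresh constant [n]. A separator of the extended pair is trimmed to constants up
    to [n]; quantifying [n] existentially then separates the original pair. *)
Lemma witness_left P Q s x (q : formula) : good P Q -> ent P (fsat s (fEx x q)) ->
  exists c, good (sand P (fsat (set_nth 0 s x c) q)) Q.
Proof.
move=> g hP; have [ns sP sQ] := g; have [n [sn nP nQ]] := common_supp g (sumn s).+1.
exists n; split; [|exact: supp_sand_fsat|by []].
move=> [m [A [dA PA AQ]]]; apply: ns.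
have [|B [dB PB BA]] := @defin_trim L n.+1 m _ A _ PA dA.
  apply: supp_sand; first exact: supp_le nP.
  move=> M e e' E; rewrite /fsat /rsat set_nth_upd.
  rewrite (_ : (fun i => _) = (fun i => e' (nth 0 (set_nth 0 s x n) i))) //.
  rewrite set_nth_upd; apply/funext => i; case: eqP => _; apply: E => //.
  by rewrite ltnS (leq_trans (nth_sumn s i)) // ltnW.
exists n, (fun M e => exists d, B M (upd e n d)); split; first exact: defin_ex.
- move=> M e p; have [d hd] := hP _ _ p; exists d; apply: PB; split.
    exact: (proj2 (supp_upd e d nP (leqnn n))).
  by rewrite rsat_fresh.
- move=> M e [d /BA /AQ h] q0; apply: h.
  exact: (proj2 (supp_upd e d nQ (leqnn n))).
Qed.

(** Here the separator is trimmed below the fresh constant [n], so reinterpreting [n] as a witness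
    of [q] changes neither the separator nor [Q]. *)
Lemma witness_right P Q s x (q : formula) : good P Q -> ent Q (fsat s (fEx x q)) ->
  exists c, good P (sand Q (fsat (set_nth 0 s x c) q)).
Proof.
move=> g hQ; have [ns sP sQ] := g; have [n [sn nP nQ]] := common_supp g (sumn s).+1.
exists n; split; [|by []|exact: supp_sand_fsat].
move=> [m [A [dA PA AQ]]]; apply: ns.
have [B [dB PB BA]] := defin_trim nP PA dA.
exists n, B; split=> // M e b q0; have [d hd] := hQ _ _ q0.
have pe : supp n B.
  case: dB => t [_ _ ft Et] M0 e0 e1 E; rewrite -!Et.
  by rewrite (@sat_fv t _ e0 e1) // => y /ft /E.
apply: (AQ M (upd e n d) (BA _ _ (proj2 (supp_upd e d pe (leqnn n)) b))); split.
  exact: (proj2 (supp_upd e d nQ (leqnn n))).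
by rewrite rsat_fresh.
Qed.

End Inseparable.

(** * Henkin steps *)

(** Deciding includes the Henkin property: accepted existentials and countable disjunctions come
    with an instance, rejected universals and countable conjunctions with a counterexample. *)
Definition decides (T : spred -> Prop) (p : formula) (s : seq nat) : Prop :=
  match p with
  | fEx x q => (exists c, T (fsat (set_nth 0 s x c) q)) \/ T (fsat s (fNot p))
  | fAll x q => T (fsat s p) \/ exists c, T (fsat (set_nth 0 s x c) (fNot q))
  | fBigAnd qs => T (fsat s p) \/ exists i, T (fsat s (fNot (qs i)))
  | fBigOr qs => (exists i, T (fsat s (qs i))) \/ T (fsat s (fNot p))
  | _ => T (fsat s p) \/ T (fsat s (fNot p))
  end.

Lemma decides_mono (T T' : spred -> Prop) p s :
  (forall A, T A -> T' A) -> decides T p s -> decides T' p s.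
Proof.
move=> h; case: p => /= [t u|r a|q|q1 q2|q1 q2|qs|qs|x q|x q].
6: by case=> [/h|[i /h]]; [left|right; exists i].
6: by case=> [[i /h]|/h]; [left; exists i|right].
6: by case=> [[i /h]|/h]; [left; exists i|right].
6: by case=> [/h|[i /h]]; [left|right; exists i].
all: by case=> /h; [left|right].
Qed.

(** Only the outermost connective counts: quantifiers and finite connectives over infinitary
    formulas are still decided on the left. *)
Definition finitary (p : formula) : bool :=
  if p is (fBigAnd _ | fBigOr _) then false else true.

(** [G] stands for either side of an inseparable pair. After a split on [p], a second step supplies
    the instance or counterexample where one is due. *)
Lemma decide_step (G : spred -> Prop) (p : formula) s P :
  (forall P p, G P -> G (sand P (fsat s p)) \/ G (sand P (fsat s (fNot p)))) ->
  (forall P x q, G P -> ent P (fsat s (fEx x q)) ->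
     exists c, G (sand P (fsat (set_nth 0 s x c) q))) ->
  (~~ finitary p -> forall P (ps : nat -> formula), G P -> ent P (fun M e => exists i, fsat s (ps i) e) ->
     exists i, G (sand P (fsat s (ps i)))) ->
  G P -> exists P', [/\ G P', ent P' P & decides (ent P') p s].
Proof.
move=> hsplit hwit homega gP.
case: (hsplit P p gP) => {}gP; last first.
  case: p gP homega => [t u|r a|q|q1 q2|q1 q2|qs|qs|x q|x q] gP homega.
  6: have [|i gi] := homega isT _ (fun i => fNot (qs i)) gP; last first.
  10: have [|c gc] := hwit _ x (fNot q) gP; last first.
  1-5,8,9: by eexists; split; [exact: gP|move=> M e []|right=> M e []].
  - by eexists; split; [exact: gi|move=> M e [[]]|right; exists i => M e []].
  - by move=> M e [_ /existsNP].
  - by eexists; split; [exact: gc|move=> M e [[]]|right; exists c => M e []].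
  - by move=> M e [_ /existsNP].
case: p gP homega => [t u|r a|q|q1 q2|q1 q2|qs|qs|x q|x q] gP homega.
7: have [|i gi] := homega isT _ qs gP; last first.
9: have [|c gc] := hwit _ x q gP; last first.
1-6,11: by eexists; split; [exact: gP|move=> M e []|left=> M e []].
- by eexists; split; [exact: gi|move=> M e [[]]|left; exists i => M e []].
- by move=> M e [].
- by eexists; split; [exact: gc|move=> M e [[]]|left; exists c => M e []].
- by move=> M e [].
Qed.

Lemma decide_left L P Q (p : formula) s : finitary p -> good L P Q ->
  exists P', [/\ good L P' Q, ent P' P & decides (ent P') p s].
Proof.
move=> fp; apply: (@decide_step (fun P => good L P Q)); last by rewrite fp.
- by move=> P' q; apply: split_left.
- by move=> P' x q; apply: witness_left.
Qed.

Lemma decide_right L P Q (p : formula) s : good L P Q ->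
  exists Q', [/\ good L P Q', ent Q' Q & decides (ent Q') p s].
Proof.
apply: (@decide_step (fun Q => good L P Q)) => [Q' q|Q' x q|_ Q' ps].
- exact: split_right.
- exact: witness_right.
- exact: split_right_omega.
Qed.

(** A decreasing chain of classes may have empty intersection, so its limit theory is kept as a
    proper filter. *)
Record filter (T : spred -> Prop) : Prop := Filter {
  filter_mono : forall A B, ent A B -> T A -> T B;
  filter_and : forall A B, T A -> T B -> T (sand A B);
  filter_true : T (fun _ _ => True);
  filter_proper : ~ T (fun _ _ => False) }.

Lemma filter_fin T (I : finType) (A : I -> spred) :
  filter T -> (forall i, T (A i)) -> T (fun M e => forall i, A i M e).
Proof.
move=> hT h.
suff hl (l : seq I) : T (fun M e => forall i, i \in l -> A i M e).
  by apply: filter_mono (hl (enum I)) => // M e H i; apply: H; rewrite mem_enum.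
elim: l => [|i l IH]; first by apply: filter_mono (filter_true hT).
apply: filter_mono (filter_and hT (h i) IH) => // M e [hi hl] j.
by rewrite inE => /orP [/eqP ->|/hl].
Qed.

Lemma filter_limit (R : nat -> spred) :
  (forall k, ent (R k.+1) (R k)) -> (forall k, ~ ent (R k) (fun _ _ => False)) ->
  filter (fun A => exists k, ent (R k) A).
Proof.
move=> Rdec Rne; have Rle i j : i <= j -> ent (R j) (R i).
  move=> /subnK <-; elim: (j - i) => [|m IH] M e; first by [].
  by move=> /Rdec /IH.
split=> [A B AB [k h]|A B [k h] [l h']||[k]]; last exact: Rne.
- by exists k => M e /h /AB.
- exists (maxn k l) => M e hR; split.
    by apply/h/(Rle _ _ (leq_maxl k l)).
  by apply/h'/(Rle _ _ (leq_maxr k l)).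
- by exists 0.
Qed.

(** Falsity separates an inconsistent [P], truth an inconsistent [Q]; equality expresses both in any
    language, at the cost of the variable 0. *)
Lemma good_proper L P Q : good L P Q ->
  ~ ent P (fun _ _ => False) /\ ~ ent Q (fun _ _ => False).
Proof.
move=> [ns _ _]; split=> h; apply: ns.
  exists 1, (fun _ _ => False); split=> //.
  exists (fNot (fEq (tvar S 0) (tvar S 0))); split=> //=.
  - by do !constructor.
  - by split=> x /= [].
  - by move=> y [] <-.
exists 1, (fun _ _ => True); split=> //; last by move=> M e _ /h.
exists (fEq (tvar S 0) (tvar S 0)); split=> //=.
- by do !constructor.
- by split=> x /= [].
- by move=> y [] <-.
Qed.

(** A task is a formula together with a list of constants. The stage numbered by its code carries it
    out, and later stages only strengthen the pair, so every decision survives to the limit. *)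
Lemma henkin_limit L (I1 I2 J : countType) (F1 : I1 -> formula) (F2 : I2 -> formula)
    (A : J -> formula) P Q :
  good L P Q -> (forall j, fin_qf (A j)) ->
  exists T1 T2, [/\ filter T1, filter T2, T1 P & T2 Q] /\
    [/\ forall i s, finitary (F1 i) -> decides T1 (F1 i) s,
        forall i s, decides T2 (F2 i) s &
        forall j s, inL L (A j) -> T1 (fsat s (A j)) <-> T2 (fsat s (A j))].
Proof.
move=> g qA.
pose K := ((I1 + I2 + J) * seq nat)%type.
pose done (k : option K) (P Q : spred) := match k with
  | Some (inl (inl i), s) => finitary (F1 i) -> decides (ent P) (F1 i) s
  | Some (inl (inr i), s) => decides (ent Q) (F2 i) s
  | Some (inr j, s) => inL L (A j) ->
      ent P (fsat s (A j)) /\ ent Q (fsat s (A j)) \/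
      ent P (fsat s (fNot (A j))) /\ ent Q (fsat s (fNot (A j)))
  | None => True
  end.
have step (x : nat * (spred * spred)) : exists y : spred * spred,
    good L x.2.1 x.2.2 -> [/\ good L y.1 y.2, ent y.1 x.2.1, ent y.2 x.2.2 &
      done (unpickle x.1) y.1 y.2].
  have refl (B : spred) : ent B B by move=> M e.
  case: x => n [P1 Q1] /=; case: (EM (good L P1 Q1)) => [g1|]; last by exists (P1, Q1).
  case: (unpickle n : option K) => [[[[i|i]|j] s]|] /=; last by exists (P1, Q1) => _; split.
  - have [fi|nfi] := boolP (finitary (F1 i)); last first.
      by exists (P1, Q1) => _; split=> // /(negP nfi).
    by have [P' [g' h d]] := decide_left s fi g1; exists (P', Q1) => _; split.
  - by have [Q' [g' h d]] := decide_right (F2 i) s g1; exists (P1, Q') => _; split.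
  - case: (EM (inL L (A j))) => [Lj|nLj]; last by exists (P1, Q1) => _; split.
    have [g'|g'] := split_both s g1 (qA j) Lj.
      exists (sand P1 (fsat s (A j)), sand Q1 (fsat s (A j))) => _.
      split; [exact: g'|by move=> M e []|by move=> M e []|by move=> _; left; split=> M e []].
    exists (sand P1 (fsat s (fNot (A j))), sand Q1 (fsat s (fNot (A j)))) => _.
      split; [exact: g'|by move=> M e []|by move=> M e []|by move=> _; right; split=> M e []].
have {step} [f hf] := choice step.
pose st := fix st k := if k is k'.+1 then f (k', st k') else (P, Q).
have gst k : good L (st k).1 (st k).2 by elim: k => [|k IH] //=; case: (hf (k, st k) IH).
have stdone (k : K) : done (Some k) (st (pickle k).+1).1 (st (pickle k).+1).2.
  by case: (hf (pickle k, st (pickle k)) (gst _)) => _ _ _; rewrite /= pickleK.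
pose T1 B := exists k, ent (st k).1 B; pose T2 B := exists k, ent (st k).2 B.
have fT1 : filter T1.
  apply: filter_limit => k; last by case: (good_proper (gst k)).
  by case: (hf (k, st k) (gst k)).
have fT2 : filter T2.
  apply: filter_limit => k; last by case: (good_proper (gst k)).
  by case: (hf (k, st k) (gst k)).
exists T1, T2; split; first by split=> //; exists 0.
split=> [i s fi|i s|j s Lj].
- by apply: decides_mono (stdone (inl (inl i), s) fi) => B; eexists; eassumption.
- by apply: decides_mono (stdone (inl (inr i), s)) => B; eexists; eassumption.
- have contra T : filter T -> T (fsat s (A j)) -> T (fsat s (fNot (A j))) -> False.
    move=> hT h1 h2; apply: (filter_proper hT).
    by apply: filter_mono (filter_and hT h1 h2) => // M e [h3]; apply.
  case: (stdone (inr j, s) Lj) => [[h1 h2]|[h1 h2]]; split=> h.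
  + by eexists; exact: h2.
  + by eexists; exact: h1.
  + by case: (contra T1 fT1 h); eexists; exact: h1.
  + by case: (contra T2 fT2 h); eexists; exact: h2.
Qed.

(** * The canonical model *)

(** Only symbols of [L] are constrained, which lets one structure serve two theories in different
    languages. *)
Record interp (T : spred -> Prop) (L : language) (M : structure S)
    (cls : nat -> dom M) : Prop := Interp {
  interp_surj : forall x, exists c, cls c = x;
  interp_eq : forall c d, cls c = cls d <-> T (fun _ e => e c = e d);
  interp_rel : forall r (a : 'I_(rel_ar r) -> nat), lang_rel L r ->
    rel_int (fun i => cls (a i)) <-> T (fun _ e => rel_int (fun i => e (a i)));
  interp_fun : forall f (a : 'I_(fun_ar f) -> nat) d, lang_fun L f ->
    fun_int (fun i => cls (a i)) = cls d <-> T (fun _ e => fun_int (fun i => e (a i)) = e d);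
  interp_const : forall c d, lang_const L c ->
    const_int M c = cls d <-> T (fun M e => const_int M c = e d) }.

(** Paths [w : seq nat] address subformulas as [foldl child p w], a countable family although there
    are uncountably many formulas. *)
Fixpoint child (p : formula) (i : nat) : formula :=
  match p with
  | fNot q | fEx _ q | fAll _ q => q
  | fAnd q1 q2 | fOr q1 q2 => if i == 0 then q1 else q2
  | fBigAnd qs | fBigOr qs => qs i
  | _ => p
  end.

(** * Truth lemmas for the canonical model *)

Section Truth.
Variables (T : spred -> Prop) (L : language) (M : structure S) (cls : nat -> dom M).
Hypotheses (hT : filter T) (hM : interp T L cls).

Local Notation env s := (fun i => cls (nth 0 s i)).

(** By induction every term is named by a constant, both in the structure and in [T]; finite arity
    lets the filter collect all arguments at once. *)
Lemma term_value (t : term) s : t_inL L t ->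
  exists d, teval (env s) t = cls d /\ T (fun M e => teval (fun i => e (nth 0 s i)) t = e d).
Proof.
elim: t => [x|c|f a IH] /=.
- by exists (nth 0 s x); split=> //; apply: filter_mono (filter_true hT).
- move=> [_ hc]; have [d hd] := interp_surj hM (const_int M c).
  by exists d; split=> //; apply/(interp_const hM); [apply: hc|rewrite hd].
- move=> /t_inL_app [hf ha].
  have /choice [b hb] i := IH i (ha i).
  have [d hd] := interp_surj hM (fun_int (fun i => cls (b i))).
  exists d; split.
    by rewrite hd; congr fun_int; apply/funext => i; case: (hb i).
  have /(interp_fun hM) h : fun_int (fun i => cls (b i)) = cls d by [].
  have hbT i := proj2 (hb i).
  apply: filter_mono (filter_and hT (h hf) (filter_fin hT hbT)) => // N e [<- h'].
  by congr fun_int; apply/funext.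
Qed.

Lemma decides_or p s : decides T p s -> T (fsat s p) \/ T (fsat s (fNot p)).
Proof.
have mono := filter_mono hT.
case: p => //= [qs|qs|x q|x q].
- by case=> [|[i h]]; [left|right; apply: mono h => N e h /(_ i)].
- by case=> [[i h]|]; [left; apply: mono h => N e h; exists i|right].
- case=> [[c h]|]; last by right.
  by left; apply: mono h => N e; rewrite /fsat /rsat set_nth_upd => h; exists (e c).
- case=> [|[c h]]; first by left.
  by right; apply: mono h => N e; rewrite /fsat /rsat /= set_nth_upd => h /(_ (e c)).
Qed.

Lemma filter_contra A : T A -> T (snot A) -> False.
Proof.
move=> h1 h2; apply: (filter_proper hT).
by apply: (filter_mono hT) (filter_and hT h1 h2) => N e [h3]; apply.
Qed.

Lemma truth p s : (forall w s, decides T (foldl child p w) s) -> inL L p ->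
  sat (env s) p <-> T (fsat s p).
Proof.
have mono := filter_mono hT.
elim: p s => [t u|r a|q IH|q1 IH1 q2 IH2|q1 IH1 q2 IH2|qs IH|qs IH|x q IH|x q IH] s D.
all: have D' i w s' := D (i :: w) s'.
- move=> /inL_eq [/(term_value s) [c [ec Tc]] /(term_value s) [d [ed Td]]] /=.
  rewrite ec ed (interp_eq hM).
  have h := filter_and hT Tc Td; split=> h'; apply: mono (filter_and hT h h').
    by move=> N e [[h1 h2] h3]; rewrite /fsat /rsat /= h1 h2.
  by move=> N e [[h1 h2]]; rewrite /fsat /rsat /= h1 h2.
- move=> /inL_rel [hr ha] /=.
  have /choice [b hb] i := term_value s (ha i).
  have -> : (fun i => teval (env s) (a i)) = (fun i => cls (b i)).
    by apply/funext => i; case: (hb i).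
  have h := filter_fin hT (fun i => proj2 (hb i)).
  rewrite (interp_rel hM) //; split=> h'; apply: mono (filter_and hT h h') => N e [E].
    by rewrite /fsat /rsat /=; rewrite (_ : (fun i => teval _ _) = (fun i => e (b i))) //; apply/funext.
  by rewrite /fsat /rsat /=; rewrite (_ : (fun i => teval _ _) = (fun i => e (b i))) //; apply/funext.
- move=> /(IH s (D' 0)) {}IH; rewrite [sat _ _]/= IH.
  split=> [h|h h']; last exact: filter_contra h' h.
  by case: (decides_or (D' 0 [::] s)).
- move=> /inL_and [/(IH1 s (D' 0)) {}IH1 /(IH2 s (D' 1)) {}IH2].
  rewrite [sat _ _]/= IH1 IH2; split=> [[h1 h2]|h]; first exact: filter_and.
  by split; apply: mono h => N e [].
- move=> /inL_and [/(IH1 s (D' 0)) {}IH1 /(IH2 s (D' 1)) {}IH2].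
  rewrite [sat _ _]/= IH1 IH2; split=> [[h|h]|h].
  + by apply: mono h; left.
  + by apply: mono h; right.
  + case: (decides_or (D' 0 [::] s)) => /= h'; first by left.
    by right; apply: mono (filter_and hT h h') => N e [[]].
- move=> /inL_bigand Lq; rewrite [sat _ _]/=.
  split=> [h|h i]; last by apply/(IH i s (D' i) (Lq i)); apply: mono h => N e; apply.
  case: (D [::] s) => //= -[i hi].
  by case: (filter_contra (proj1 (IH i s (D' i) (Lq i)) (h i)) hi).
- move=> /inL_bigand Lq; rewrite [sat _ _]/=.
  split=> [[i /IH h]|h]; first by apply: mono (h (D' i) (Lq i)) => N e h'; exists i.
  case: (D [::] s) => /= [[i hi]|h']; first by exists i; apply/(IH i s (D' i) (Lq i)).
  by case: (filter_contra h h').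
- move=> Lq; rewrite [sat _ _]/=; split=> [[d]|h].
    have [c <-] := interp_surj hM d.
    (* Since every element is the class of a constant, the updated environment again comes from a
       list. *)
    rewrite /upd -(set_nth_upd cls) => /(IH _ (D' 0) Lq) h.
    by apply: mono h => N e; rewrite /fsat /rsat set_nth_upd => h; exists (e c).
  case: (D [::] s) => /= [[c hc]|h']; last by case: (filter_contra h h').
  by exists (cls c); rewrite /upd -(set_nth_upd cls); apply/(IH _ (D' 0) Lq).
- move=> Lq; rewrite [sat _ _]/=; split=> [h|h d].
    case: (D [::] s) => //= -[c hc].
    have /(IH _ (D' 0) Lq) h' : sat (env (set_nth 0 s x c)) q.
      by rewrite set_nth_upd; apply: h.
    by case: (filter_contra h' hc).
  have [c <-] := interp_surj hM d.
  rewrite /upd -(set_nth_upd cls); apply/(IH _ (D' 0) Lq).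
  by apply: mono h => N e; rewrite /fsat /rsat set_nth_upd; apply.
Qed.

Lemma fin_qf_sub p w : fin_qf p -> fin_qf (foldl child p w).
Proof.
elim: w p => [|i w IH] p //= hp; apply: IH; case: hp => //=; try by constructor.
- by move=> q1 q2; case: (i == 0).
- by move=> q1 q2; case: (i == 0).
Qed.

(** Only membership in [T] implying truth is claimed: a countable conjunction in [T] passes to its
    conjuncts by monotonicity, so no infinitary decision is needed. Quantifier-free formulas fall
    under [truth]. *)
Lemma WW_truth p s : WW p ->
  (forall w s, finitary (foldl child p w) -> decides T (foldl child p w) s) ->
  inL L p -> T (fsat s p) -> sat (env s) p.
Proof.
have mono := filter_mono hT.
move=> hp; elim: hp s => {p} [q hq|x q _ IH|x q _ IH|qs _ IH _] s D Lq h.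
- apply/truth => // w s'; apply: D.
  by case: (foldl child q w) / (fin_qf_sub w hq).
- case: (D [::] s isT) => /= [[c hc]|h']; last by case: (filter_contra h h').
  exists (cls c); rewrite /upd -(set_nth_upd cls); apply: IH => // w s'.
  exact: (D (0 :: w)).
- move=> d; have [c <-] := interp_surj hM d.
  rewrite /upd -(set_nth_upd cls); apply: IH => // [w s'|]; first exact: (D (0 :: w)).
  by apply: mono h => N e; rewrite /fsat /rsat set_nth_upd; apply.
- move=> i; apply: IH; first by move=> w s'; exact: (D (i :: w)).
  + by move/inL_bigand: Lq.
  + by apply: mono h => N e; apply.
Qed.

End Truth.

(** Provable equality is an equivalence relation on constants; the least constant of each class
    represents it. *)
Lemma eq_representative T : filter T -> exists rep : nat -> nat,
  forall c d, T (fun M e => e c = e d) <-> rep c = rep d.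
Proof.
move=> hT; pose E c d := T (fun M e => e c = e d).
have Erefl c : E c c by apply: filter_mono (filter_true hT).
have Esym c d : E c d -> E d c by apply: filter_mono.
have Etrans c d k : E c d -> E d k -> E c k.
  by move=> h1 h2; apply: filter_mono (filter_and hT h1 h2) => // M e [-> ->].
have ex c : exists d, `[< E c d >] by exists c; apply/asboolP.
exists (fun c => ex_minn (ex c)) => c d; split=> [h|].
  by apply: eq_ex_minn => k; apply/asboolP/asboolP; apply: Etrans => //; apply: Esym.
case: ex_minnP => k /asboolP h1 _; case: ex_minnP => l /asboolP h2 _ kl.
by apply: Etrans h1 _; rewrite kl; apply: Esym.
Qed.

Lemma canonical_model (T1 T2 : spred -> Prop) (L1 L2 : language) :
  filter T1 -> filter T2 ->
  (forall c d, T1 (fun M e => e c = e d) <-> T2 (fun M e => e c = e d)) ->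
  (forall r (a : 'I_(rel_ar r) -> nat), lang_rel L1 r -> lang_rel L2 r ->
     T1 (fun M e => rel_int (fun i => e (a i))) <-> T2 (fun M e => rel_int (fun i => e (a i)))) ->
  (forall f (a : 'I_(fun_ar f) -> nat) d, lang_fun L1 f -> lang_fun L2 f ->
     T1 (fun M e => fun_int (fun i => e (a i)) = e d) <->
     T2 (fun M e => fun_int (fun i => e (a i)) = e d)) ->
  (forall c d, lang_const L1 c -> lang_const L2 c ->
     T1 (fun M e => const_int M c = e d) <-> T2 (fun M e => const_int M c = e d)) ->
  (forall f (a : 'I_(fun_ar f) -> nat),
     (lang_fun L1 f -> exists d, T1 (fun M e => fun_int (fun i => e (a i)) = e d)) /\
     (lang_fun L2 f -> exists d, T2 (fun M e => fun_int (fun i => e (a i)) = e d))) ->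
  (forall c,
     (lang_const L1 c -> exists d, T1 (fun M e => const_int M c = e d)) /\
     (lang_const L2 c -> exists d, T2 (fun M e => const_int M c = e d))) ->
  exists (M : structure S) (cls : nat -> dom M), interp T1 L1 cls /\ interp T2 L2 cls.
Proof.
move=> hT1 hT2 hE hR hF hC wF wC.
have [rep hrep] := eq_representative hT1.
pose D := {x : nat | `[< exists c, rep c = x >]}.
pose cls c : D := exist _ (rep c) (introT (asboolP _) (ex_intro _ c erefl)).
have cls_surj (x : D) : exists c, cls c = x.
  by case: x => x hx; have /asboolP [c hc] := hx; exists c; apply: val_inj.
have cls_eq1 c d : cls c = cls d <-> T1 (fun M e => e c = e d).
  by rewrite hrep; split=> [[]|h] //; apply: val_inj.
have cls_eq2 c d : cls c = cls d <-> T2 (fun M e => e c = e d) by rewrite cls_eq1 hE.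
have {cls_surj} [nm nmK] := choice cls_surj.
pose FA := {f : fun_sym S & 'I_(fun_ar f) -> nat}.
have /choice [vf hvf] (x : FA) : exists d,
    (lang_fun L1 (projT1 x) -> T1 (fun M e => fun_int (fun i => e (projT2 x i)) = e d)) /\
    (lang_fun L2 (projT1 x) -> T2 (fun M e => fun_int (fun i => e (projT2 x i)) = e d)).
  case: x => f a /=; have [w1 w2] := wF f a.
  case: (EM (lang_fun L1 f)) => [f1|nf1].
    by have [d hd] := w1 f1; exists d; split=> // f2; apply/hF.
  case: (EM (lang_fun L2 f)) => [f2|nf2]; last by exists 0.
  by have [d hd] := w2 f2; exists d.
have /choice [vc hvc] (c : const_sym S) : exists d,
    (lang_const L1 c -> T1 (fun M e => const_int M c = e d)) /\
    (lang_const L2 c -> T2 (fun M e => const_int M c = e d)).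
  have [w1 w2] := wC c.
  case: (EM (lang_const L1 c)) => [f1|nf1].
    by have [d hd] := w1 f1; exists d; split=> // f2; apply/hC.
  case: (EM (lang_const L2 c)) => [f2|nf2]; last by exists 0.
  by have [d hd] := w2 f2; exists d.
(* Elements are the representatives. On shared relation symbols the two disjuncts agree by [hR]; on
   others at most one can hold. The values [vf] and [vc] suit both theories. *)
pose M := @Structure S D (inhabits (cls 0))
  (fun r a => lang_rel L1 r /\ T1 (fun M e => rel_int (fun i => e (nm (a i)))) \/
              lang_rel L2 r /\ T2 (fun M e => rel_int (fun i => e (nm (a i)))))
  (fun f a => cls (vf (existT _ f (fun i => nm (a i))))) (fun c => cls (vc c)).
have interpM T L : filter T -> (forall c d, cls c = cls d <-> T (fun M e => e c = e d)) ->
    (forall r (a : 'I_(rel_ar r) -> dom M), lang_rel L r ->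
       rel_int a <-> T (fun M e => rel_int (fun i => e (nm (a i))))) ->
    (forall f (a : 'I_(fun_ar f) -> nat), lang_fun L f ->
       T (fun M e => fun_int (fun i => e (a i)) = e (vf (existT _ f a)))) ->
    (forall c, lang_const L c -> T (fun M e => const_int M c = e (vc c))) ->
    @interp T L M cls.
  move=> hT cls_eq hr hf hc.
  (* [nm] may name a class by another of its constants, but [T] identifies the two. *)
  have nm_cls n (a : 'I_n -> nat) : T (fun M e => (fun i => e (a i)) = (fun i => e (nm (cls (a i))))).
    apply: (filter_mono hT) (filter_fin hT (A := fun i M e => e (a i) = e (nm (cls (a i)))) _).
      by move=> N e h; apply/funext.
    by move=> i; apply/cls_eq; rewrite nmK.
  split=> [x||r a Lr|f a d Lf|c d Lc].
  - by exists (nm x); apply: nmK.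
  - exact: cls_eq.
  - rewrite hr //; split=> h; apply: (filter_mono hT) (filter_and hT (nm_cls _ a) h).
      by move=> N e [->].
    by move=> N e [<-].
  - rewrite /= cls_eq; have := filter_and hT (nm_cls _ a) (hf f (fun i => nm (cls (a i))) Lf).
    by move=> h; split=> h'; apply: (filter_mono hT) (filter_and hT h h') => N e [[-> ->]].
  - rewrite /= cls_eq; split=> h; apply: (filter_mono hT) (filter_and hT (hc c Lc) h).
      by move=> N e [->].
    by move=> N e [<-].
exists M, cls; split.
  apply: interpM => //= [r a L1r|f a|c].
  - by split=> [[[]|[L2r]]|] //; [rewrite hR|left].
  - by case: (hvf (existT _ f a)).
  - by case: (hvc c).
apply: interpM => //= [r a L2r|f a|c].
- by split=> [[[L1r]|[]]|] //; [rewrite hR|right].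
- by case: (hvf (existT _ f a)).
- by case: (hvc c).
Qed.

(** * Common language, tasks, and the interpolant *)

Definition lang_of (p : formula) : language :=
  Language (fun r => occ_rel r p) (fun f => occ_fun f p) (fun c => occ_const c p).

Definition lang_meet (L1 L2 : language) : language :=
  Language (fun r => lang_rel L1 r /\ lang_rel L2 r) (fun f => lang_fun L1 f /\ lang_fun L2 f)
    (fun c => lang_const L1 c /\ lang_const L2 c).

Definition atom_index : countType := (unit + rel_sym S + fun_sym S + const_sym S)%type.

(** Unnested atoms suffice: their instances under lists of constants fix the canonical structure
    once all values are named. *)
Definition atom (j : atom_index) : formula :=
  match j with
  | inl (inl (inl _)) => fEq (tvar S 0) (tvar S 1)
  | inl (inl (inr r)) => @fRel S r (fun i => tvar S i)
  | inl (inr f) => fEq (@tapp S f (fun i => tvar S i)) (tvar S (fun_ar f))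
  | inr c => fEq (tconst c) (tvar S 0)
  end.

(** These formulas are valid, so deciding them forces constants naming all values. *)
Definition value_exists (j : fun_sym S + const_sym S) : formula :=
  match j with
  | inl f => fEx (fun_ar f) (atom (inl (inr f)))
  | inr c => fEx 0 (atom (inr c))
  end.

Definition subformula_or_value (p : formula) (i : seq nat + (fun_sym S + const_sym S)) : formula :=
  match i with inl w => foldl child p w | inr j => value_exists j end.

(** Position [n] is not an ordinal below [n], so it receives [d], the value slot of a function
    atom. *)
Definition with_values n (a : 'I_n -> nat) (d : nat) : seq nat :=
  mkseq (fun i => if insub i is Some o then a o else d) n.+1.

Lemma with_values_fst n (a : 'I_n -> nat) d (T : Type) (e : nat -> T) :
  (fun i : 'I_n => e (nth 0 (with_values a d) i)) = (fun i => e (a i)).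
Proof. by apply/funext => i; rewrite nth_mkseq ?valK // ltnS ltnW. Qed.

Lemma with_values_last n (a : 'I_n -> nat) d : nth 0 (with_values a d) n = d.
Proof. by rewrite nth_mkseq // insubF // ltnn. Qed.

Lemma decides_fun T f (a : 'I_(fun_ar f) -> nat) :
  filter T -> (forall s, decides T (value_exists (inl f)) s) ->
  exists d, T (fun M e => fun_int (fun i => e (a i)) = e d).
Proof.
(* The final 0 is a placeholder, overwritten by the witness. *)
move=> hT /(_ (with_values a 0)) [[d h]|h].
  exists d; apply: filter_mono h => // M e; rewrite /fsat /rsat set_nth_upd /= eqxx => <-.
  congr fun_int; rewrite -(with_values_fst a 0); apply/funext => i.
  by case: eqP => // E; have := ltn_ord i; rewrite E ltnn.
case: (filter_proper hT); apply: filter_mono h => // M e; apply.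
set v := fun_int (fun i : 'I_(fun_ar f) => e (nth 0 (with_values a 0) i)).
exists v; rewrite /= /upd eqxx; congr fun_int; apply/funext => i.
by case: eqP => // E; have := ltn_ord i; rewrite E ltnn.
Qed.

Lemma decides_const T c :
  filter T -> (forall s, decides T (value_exists (inr c)) s) ->
  exists d, T (fun M e => const_int M c = e d).
Proof.
move=> hT /(_ [::]) [[d h]|h].
  by exists d; apply: filter_mono h => // M e; rewrite /fsat /rsat set_nth_upd.
case: (filter_proper hT); apply: filter_mono h => // M e; apply.
by exists (const_int M c).
Qed.

Lemma WW_wf (p : formula) : WW p -> wf p.
Proof. by elim=> //= q; elim. Qed.

Lemma interpolation (phi1 phi2 : formula) :
  sentence phi1 -> WW phi1 -> sentence phi2 -> entails phi1 phi2 ->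
  exists theta : formula, [/\ sentence theta, WW theta,
    entails phi1 theta, entails theta phi2 & inL (lang_meet (lang_of phi1) (lang_of phi2)) theta].
Proof.
set L := lang_meet _ _ => s1 W1 s2 E12.
pose P : spred := fun M e => sat e phi1; pose Q : spred := fun M e => ~ sat e phi2.
have sP : supp 0 P by apply: supp_fv => y /(proj2 s1).
have sQ : supp 0 Q by apply/supp_snot/supp_fv => y /(proj2 s2).
have [[n [A [dA PA AQ]]]|nsep] := EM (sep L P Q).
  (* As [P] has support 0, trimming closes the separator into a sentence, which is the
     interpolant. *)
  have [B [[t [Wt Lt ft Et]] PB BA]] := defin_trim sP PA dA.
  exists t; split=> //.
  - by split; [apply: WW_wf|move=> y /ft].
  - by move=> M e /PB /Et.
  - by move=> M e /Et /BA /AQ /contrapT.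
have g : good L P Q by split=> //; exists 0.
have qA j : fin_qf (atom j) by case: j => [[[[]|r]|f]|c]; constructor.
have [T1 [T2 [[hT1 hT2 TP TQ] [D1 D2 TA]]]] :=
  henkin_limit (subformula_or_value phi1) (subformula_or_value phi2) g qA.
have [M [cls [M1 M2]]] : exists (M : structure S) (cls : nat -> dom M),
    interp T1 (lang_of phi1) cls /\ interp T2 (lang_of phi2) cls.
  apply: canonical_model => // [c d|r a r1 r2|f a d f1 f2|c d c1 c2|f a|c].
  - by have := TA (inl (inl (inl tt))) [:: c; d]; apply; split=> r /= [].
  - have := TA (inl (inl (inr r))) (with_values a 0).
    have -> : fsat (with_values a 0) (atom (inl (inl (inr r)))) =
        (fun M e => rel_int (fun i => e (a i))).
      by apply: functional_extensionality_dep => M; apply/funext => e; rewrite -(with_values_fst a 0).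
    by apply; split=> x /= => [<-|[]|[]].
  - have := TA (inl (inr f)) (with_values a d).
    have -> : fsat (with_values a d) (atom (inl (inr f))) =
        (fun M e => fun_int (fun i => e (a i)) = e d).
      apply: functional_extensionality_dep => M; apply/funext => e.
      by rewrite -(with_values_fst a d) /fsat /rsat /= with_values_last.
    by apply; split=> x /= => [[]|[[<-|[]]|]|[[]|]].
  - have := TA (inr c) [:: d]; apply; split=> x /= => [[]|[]|[<-|]] //.
  - by split=> _; apply: decides_fun => // s; [apply: (D1 (inr (inl f)))|apply: (D2 (inr (inl f)))].
  - by split=> _; apply: decides_const => // s; [apply: (D1 (inr (inr c)))|apply: (D2 (inr (inr c)))].
have inLof p : inL (lang_of p) p by [].
have Pnil T (p : formula) : filter T -> sentence p -> T (fun M e => sat e p) -> T (fsat [::] p).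
  move=> hT [_ hp]; apply: filter_mono => // N e h.
  by rewrite /fsat /rsat (@sat_fv p _ _ e) // => y /hp.
have sat1 : sat (fun i => cls (nth 0 [::] i)) phi1.
  apply: (WW_truth hT1 M1) => //; last exact: Pnil.
  by move=> w s; apply: (D1 (inl w)).
(* The canonical model satisfies [phi1], hence [phi2], so [T2] contains [phi2] along with its
   negation. *)
have /(truth hT2 M2 [::] (fun w => D2 (inl w)) (inLof phi2)) sat2 := E12 _ _ sat1.
by case: (filter_contra hT2 sat2 (Pnil T2 (fNot phi2) hT2 s2 TQ)).
Qed.

End Interpolation.

Theorem theorem4p4 (S : signature) (phi1 phi2 : formula S) :
  sentence phi1 -> WW phi1 -> sentence phi2 ->
  entails phi1 phi2 ->
  exists theta : formula S,
    sentence theta /\ WW theta /\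
    entails phi1 theta /\ entails theta phi2 /\
    (forall r, occ_rel r theta -> occ_rel r phi1 /\ occ_rel r phi2) /\
    (forall f, occ_fun f theta -> occ_fun f phi1 /\ occ_fun f phi2) /\
    (forall c, occ_const c theta -> occ_const c phi1 /\ occ_const c phi2).
Proof.
move=> s1 W1 s2 E12.
have [theta [st Wt E1 E2 [hr hf hc]]] := interpolation s1 W1 s2 E12.
by exists theta.
Qed.
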